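(* Let $X$ be a pointed metric space and $E$ a Banach space over $\mathbb{K}$. Then $\varepsilon$ is the least dualizable Lipschitz cross-norm on $X\boxtimes E$; that is, $\varepsilon$ is a dualizable Lipschitz cross-norm on $X\boxtimes E$, and $\varepsilon(u)\leq\alpha(u)$ for every dualizable Lipschitz cross-norm $\alpha$ on $X\boxtimes E$ and every $u\in X\boxtimes E$.
   Context: $\mathbb{K}$ is $\mathbb{R}$ or $\mathbb{C}$. A pointed metric space $X$ is a metric space (with metric $d$) with a distinguished base point $0$. For a pointed metric space $X$ and a Banach space $F$, $\mathrm{Lip}_0(X,F)$ is the Banach space of all Lipschitz maps $f\colon X\to F$ with $f(0)=0$, normed by the least Lipschitz constant $\mathrm{Lip}(f)$; $X^\#=\mathrm{Lip}_0(X,\mathbb{K})$. $B_Z$ denotes the closed unit ball of a normed space $Z$. $E^*$ is the topological dual of $E$ and $\langle\phi,e\rangle=\phi(e)$; $V'$ denotes the algebraic dual of a vector space $V$. For $x,y\in X$ and $e\in E$, $\delta_{(x,y)}\boxtimes e\in \mathrm{Lip}_0(X,E^* )'$ is the linear functional $f\mapsto\langle f(x)-f(y),e\rangle$. The Lipschitz tensor product $X\boxtimes E$ is the linear subspace of $\mathrm{Lip}_0(X,E^* )'$ spanned by all the functionals $\delta_{(x,y)}\boxtimes e$ with $x,y\in X$, $e\in E$. Every $u\in X\boxtimes E$ can be written (non-uniquely) as $u=\sum_{i=1}^n\delta_{(x_i,y_i)}\boxtimes e_i$. For $u=\sum_{i=1}^n \delta_{(x_i,y_i)}\boxtimes e_i\in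 X\boxtimes E$ (independently of the representation), $$\varepsilon(u)=\sup\left\{\left|\sum_{i=1}^n(g(x_i)-g(y_i))\langle\phi,e_i\rangle\right|\colon g\in B_{X^\#},\ \phi\in B_{E^*}\right\}.$$ A norm $\alpha$ on $X\boxtimes E$ is a Lipschitz cross-norm if $\alpha(\delta_{(x,y)}\boxtimes e)=d(x,y)\|e\|$ for all $x,y\in X$, $e\in E$. A Lipschitz cross-norm $\alpha$ is dualizable if for all $g\in X^\#$, $\phi\in E^*$ and all $\sum_{i=1}^n\delta_{(x_i,y_i)}\boxtimes e_i\in X\boxtimes E$, $\left|\sum_{i=1}^n(g(x_i)-g(y_i))\langle\phi,e_i\rangle\right|\leq\mathrm{Lip}(g)\|\phi\|\,\alpha\left(\sum_{i=1}^n \delta_{(x_i,y_i)}\boxtimes e_i\right)$. *)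

(* Defs.v *)
From HB Require Import structures.
From mathcomp Require Import all_boot all_order all_algebra.
From mathcomp Require Import complex.
From mathcomp Require Import all_classical all_reals topology normedtype.

Set Implicit Arguments.
Unset Strict Implicit.
Unset Printing Implicit Defensive.

Import Order.TTheory GRing.Theory Num.Theory.
Import numFieldNormedType.Exports.

Local Open Scope classical_set_scope.
Local Open Scope ring_scope.

Inductive scalar_kind := RealScalars | ComplexScalars.

Definition scalars (R : realType) (k : scalar_kind) : numFieldType :=
  match k with RealScalars => R | ComplexScalars => R[i] end.

Section scalars_theory.
Context {R : realType}.

Definition real_of {k} : scalars R k -> R :=
  match k return scalars R k -> R with
  | RealScalars => fun r : R => r
  | ComplexScalars => @complex.Re R
  end.

Definition of_real {k} : R -> scalars R k :=
  match k return R -> scalars R k with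
  | RealScalars => fun r : R => r
  | ComplexScalars => real_complex R
  end.

Variable k : scalar_kind.
Local Notation K := (scalars R k).

Lemma of_realK : cancel (@of_real k) real_of.
Proof. by case: k. Qed.

Lemma real_ofK (z : K) : 0 <= z -> of_real (real_of z) = z.
Proof. by case: k z => //= -[a b]; rewrite lecE /= => /andP[/eqP-> _]. Qed.

Lemma of_realD a b : of_real (a + b) = of_real a + of_real b :> K.
Proof. by case: k => //=; rewrite rmorphD. Qed.

Lemma of_realM a b : of_real (a * b) = of_real a * of_real b :> K.
Proof. by case: k => //=; rewrite rmorphM. Qed.

Lemma of_real0 : of_real 0 = 0 :> K.
Proof. by case: k. Qed.

Lemma of_real1 : of_real 1 = 1 :> K.
Proof. by case: k. Qed.

Lemma ler_of_real a b : (of_real a <= of_real b :> K) = (a <= b).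
Proof. by case: k => //=; rewrite lecR. Qed.

(* The library norm on a normed module takes values in the scalar field, also
   over R[i]; normR is the same norm as an element of R. *)
Definition normR {V : normedZmodType K} (v : V) : R := real_of `|v|.

End scalars_theory.
Arguments normR {R k V} v.

Section normR_theory.
Context {R : realType} {k : scalar_kind}.
Local Notation K := (scalars R k).

Lemma of_normR (V : normedZmodType K) (v : V) : of_real (normR v) = `|v|.
Proof. by rewrite real_ofK. Qed.

Lemma normR_ge0 (V : normedZmodType K) (v : V) : 0 <= normR v.
Proof. by rewrite -(ler_of_real k) of_normR of_real0. Qed.

Lemma normRD (V : normedZmodType K) (u v : V) :
  normR (u + v) <= normR u + normR v.
Proof. by rewrite -(ler_of_real k) of_realD !of_normR ler_normD. Qed.

Lemma normR0 (V : normedZmodType K) : normR (0 : V) = 0.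
Proof. by rewrite /normR normr0 -(of_real0 k) of_realK. Qed.

Lemma normR_eq0 (V : normedZmodType K) (v : V) : normR v = 0 -> v = 0.
Proof. by move=> v0; apply/normr0_eq0; rewrite -of_normR v0 of_real0. Qed.

Lemma normRN (V : normedZmodType K) (v : V) : normR (- v) = normR v.
Proof. by rewrite /normR normrN. Qed.

Lemma normRM (a b : K) : normR (a * b) = normR a * normR b.
Proof.
by apply: (can_inj (@of_realK R k)); rewrite of_realM !of_normR normrM.
Qed.

Lemma normRZ (V : normedModType K) (a : K) (v : V) :
  normR (a *: v) = normR a * normR v.
Proof.
by apply: (can_inj (@of_realK R k)); rewrite of_realM !of_normR normrZ.
Qed.

Lemma normR_of_real (r : R) : 0 <= r -> normR (of_real r : K) = r.
Proof.
move=> r0; apply: (can_inj (@of_realK R k)); rewrite of_normR ger0_norm//.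
by rewrite -(of_real0 k) ler_of_real.
Qed.

Definition closed_unit_ball (Z : normedModType K) : set Z :=
  [set z | normR z <= 1].

End normR_theory.
Arguments closed_unit_ball {R k} Z _.

Section topological_dual.
Context {R : realType} {k : scalar_kind}.
Local Notation K := (scalars R k).
Variable E : normedModType K.

Definition dual_pred : {pred E -> K^o} :=
  mem [set f : E -> K^o | linear f /\ continuous f].

Lemma dual_submod_closed : submod_closed dual_pred.
Proof.
split.
  apply/mem_set; split; last exact: cst_continuous.
  by move=> a u v; rewrite /= scaler0 addr0.
move=> a f g /set_mem[lf cf] /set_mem[lg cg]; apply/mem_set; split.
  move=> b u v; rewrite !fctE lf lg !scalerDr !scalerA [a * b]mulrC.
  by rewrite -!addrA; congr (_ + _); rewrite addrCA.
move=> x; apply: cvgD; last exact: cg.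
by apply: cvgZr; exact: cf.
Qed.

HB.instance Definition _ :=
  GRing.isSubmodClosed.Build _ _ dual_pred dual_submod_closed.

Record dual := Dual {
  dual_fun :> E -> K^o ;
  dual_funP : dual_fun \in dual_pred }.

HB.instance Definition _ := [isSub for dual_fun].
HB.instance Definition _ := [Choice of dual by <:].
HB.instance Definition _ := [SubChoice_isSubLmodule of dual by <:].


Lemma dual_linear (phi : dual) : linear phi.
Proof. by have /set_mem[] := dual_funP phi. Qed.

Lemma dual_continuous (phi : dual) : continuous phi.
Proof. by have /set_mem[] := dual_funP phi. Qed.

HB.instance Definition _ (phi : dual) :=
  GRing.isLinear.Build K E K^o *:%R phi (@dual_linear phi).

Definition dual_norm (phi : dual) : R :=
  sup [set normR (phi e) | e in [set e | normR e <= 1]].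

Lemma dual_bounded (phi : dual) :
  exists2 C, 0 <= C & forall e, normR (phi e) <= C * normR e.
Proof.
have /(continuous_linear_bounded (0 : E)) : {for 0, continuous phi}.
  exact: dual_continuous.
move=> /linear_boundedP/pinfty_ex_gt0[M M0 phiM].
exists (normR M); first exact: normR_ge0.
move=> e; rewrite -(ler_of_real k) of_realM !of_normR.
by rewrite (gtr0_norm M0); exact: phiM.
Qed.

Lemma dual_norm_has_sup (phi : dual) :
  has_sup [set normR (phi e) | e in [set e | normR e <= 1]].
Proof.
split; first by exists (normR (phi 0)), 0 => //=; rewrite normR0.
have [C C0 phiC] := dual_bounded phi.
exists C => _ [e /= e1 <-]; rewrite (le_trans (phiC e))//.
by rewrite -[leRHS]mulr1 ler_wpM2l.
Qed.

Lemma dual_norm_ge0 (phi : dual) : 0 <= dual_norm phi.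
Proof.
apply: le_trans (normR_ge0 (phi 0)) _.
by apply: (sup_upper_bound (dual_norm_has_sup phi)); exists 0; rewrite //= normR0.
Qed.

Lemma dual_normP (phi : dual) e : normR (phi e) <= dual_norm phi * normR e.
Proof.
have := normR_ge0 e; rewrite le_eqVlt => /predU1P[/esym/normR_eq0 ->|e0].
  by rewrite linear0 !normR0 mulr0.
have le0 : 0 <= (normR e)^-1 by rewrite invr_ge0 ltW.
rewrite -ler_pdivrMr// mulrC -{1}(@normR_of_real R k _ le0).
rewrite -(normRZ (of_real _) (phi e : K^o)) -linearZ.
apply: (sup_upper_bound (dual_norm_has_sup phi)); eexists; last reflexivity.
by rewrite /= normRZ normR_of_real// mulVf// gt_eqF.
Qed.

Lemma dual_norm_le (phi : dual) C :
  (forall e, normR e <= 1 -> normR (phi e) <= C) -> dual_norm phi <= C.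
Proof.
move=> phiC; apply: ge_sup; first by case: (dual_norm_has_sup phi).
by move=> _ [e e1 <-]; exact: phiC.
Qed.

Fact dual_normD (phi psi : dual) :
  of_real (dual_norm (phi + psi)) <=
  of_real (dual_norm phi) + of_real (dual_norm psi) :> K.
Proof.
rewrite -of_realD ler_of_real; apply: dual_norm_le => e e1.
rewrite (le_trans (normRD (phi e) (psi e)))// lerD//;
  apply: (sup_upper_bound (dual_norm_has_sup _)); by exists e.
Qed.

Fact dual_normZ (a : K) (phi : dual) :
  of_real (dual_norm (a *: phi)) = `|a| * of_real (dual_norm phi).
Proof.
rewrite -of_normR -of_realM; congr of_real.
have scale_le (b : K) (psi : dual) :
    dual_norm (b *: psi) <= normR b * dual_norm psi.
  apply: dual_norm_le => e e1; rewrite (normRZ b (psi e : K^o)).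
  by rewrite ler_wpM2l ?normR_ge0//;
    apply: (sup_upper_bound (dual_norm_has_sup _)); exists e.
apply/eqP; rewrite eq_le scale_le/=.
have [->|a0] := eqVneq a 0.
  by rewrite normR0 mul0r dual_norm_ge0.
have na0 : 0 < normR a.
  by rewrite lt_neqAle normR_ge0 andbT; apply/eqP => /esym/normR_eq0/eqP;
    rewrite (negbTE a0).
have {1}-> : phi = a^-1 *: (a *: phi) by rewrite scalerA mulVf// scale1r.
rewrite (le_trans (ler_wpM2l (ltW na0) (scale_le _ _)))// mulrA -normRM.
by rewrite mulfV// -(of_real1 k) normR_of_real// mul1r.
Qed.

Fact dual_norm_eq0 (phi : dual) : of_real (dual_norm phi) = 0 :> K -> phi = 0.
Proof.
rewrite -(of_real0 k) => /(can_inj (@of_realK R k)) phi0.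
apply/val_inj/funext => e /=; apply: normR_eq0; apply/eqP.
by rewrite eq_le normR_ge0 andbT (le_trans (dual_normP phi e))// phi0 mul0r.
Qed.

HB.instance Definition _ := @Lmodule_isNormed.Build K dual
  (fun phi => of_real (dual_norm phi)) dual_normD dual_normZ dual_norm_eq0.

Lemma normR_dual (phi : dual) : normR phi = dual_norm phi.
Proof. exact: of_realK. Qed.

End topological_dual.

Section lipschitz_space.
Context {R : realType} {k : scalar_kind}.
Local Notation K := (scalars R k).
Variables (X : metricType R) (x0 : X) (F : normedModType K).

Definition lipschitz_with (C : R) (f : X -> F) :=
  forall x y, normR (f x - f y) <= C * mdist x y.

Definition Lip0_pred : {pred X -> F} :=
  mem [set f : X -> F | (exists C, lipschitz_with C f) /\ f x0 = 0].

Lemma Lip0_submod_closed : submod_closed Lip0_pred.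
Proof.
split.
  apply/mem_set; split => //; exists 0 => x y.
  by rewrite mul0r subrr normR0.
move=> a f g /set_mem[[C fC] f0] /set_mem[[D gD] g0]; apply/mem_set; split.
  exists (normR a * C + D) => x y; rewrite !fctE opprD addrACA -scalerBr.
  rewrite (le_trans (normRD _ _))// mulrDl lerD//.
  by rewrite normRZ -mulrA ler_wpM2l// normR_ge0.
by rewrite !fctE f0 g0 scaler0 addr0.
Qed.

HB.instance Definition _ :=
  GRing.isSubmodClosed.Build _ _ Lip0_pred Lip0_submod_closed.

Record Lip0 := MkLip0 {
  Lip0_fun :> X -> F ;
  Lip0_funP : Lip0_fun \in Lip0_pred }.

HB.instance Definition _ := [isSub for Lip0_fun].
HB.instance Definition _ := [Choice of Lip0 by <:].
HB.instance Definition _ := [SubChoice_isSubLmodule of Lip0 by <:].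

Definition Lip (f : Lip0) : R :=
  inf [set C | 0 <= C /\ lipschitz_with C f].

Lemma Lip0_base (f : Lip0) : f x0 = 0.
Proof. by have /set_mem[] := Lip0_funP f. Qed.

Lemma Lip_has_inf (f : Lip0) : has_inf [set C | 0 <= C /\ lipschitz_with C f].
Proof.
have /set_mem[[C fC] _] := Lip0_funP f.
split; last by exists 0 => D [].
exists `|C|; split => // x y; rewrite (le_trans (fC x y))//.
by rewrite ler_wpM2r ?ler_norm// mdist_ge0.
Qed.

Lemma Lip_ge0 (f : Lip0) : 0 <= Lip f.
Proof. by apply: lb_le_inf => [|C []//]; have [] := Lip_has_inf f. Qed.

Lemma Lip_le (f : Lip0) C : 0 <= C -> lipschitz_with C f -> Lip f <= C.
Proof. by move=> C0 fC; apply: ge_inf => //; have [] := Lip_has_inf f. Qed.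

Lemma LipP (f : Lip0) : lipschitz_with (Lip f) f.
Proof.
move=> x y; have := mdist_ge0 x y; rewrite le_eqVlt => /predU1P[d0|d0].
  have /set_mem[[C fC] _] := Lip0_funP f.
  by rewrite (le_trans (fC x y))// -d0 !mulr0.
rewrite -ler_pdivrMr//; apply: lb_le_inf; first by have [] := Lip_has_inf f.
by move=> C [C0 fC]; rewrite ler_pdivrMr.
Qed.

Fact LipD (f g : Lip0) :
  of_real (Lip (f + g)) <= of_real (Lip f) + of_real (Lip g) :> K.
Proof.
rewrite -of_realD ler_of_real; apply: Lip_le.
  by rewrite addr_ge0// Lip_ge0.
move=> x y; rewrite [X in normR X](_ : _ = f x - f y + (g x - g y)); last first.
  by rewrite opprD addrACA.
by rewrite (le_trans (normRD _ _))// mulrDl lerD// LipP.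
Qed.

Fact LipZ (a : K) (f : Lip0) :
  of_real (Lip (a *: f)) = `|a| * of_real (Lip f).
Proof.
rewrite -of_normR -of_realM; congr of_real.
have scale_le (b : K) (g : Lip0) : Lip (b *: g) <= normR b * Lip g.
  apply: Lip_le => [|x y]; first by rewrite mulr_ge0 ?normR_ge0 ?Lip_ge0.
  rewrite [X in normR X](_ : _ = b *: (g x - g y)); last first.
    by rewrite scalerBr.
  by rewrite normRZ -mulrA ler_wpM2l ?normR_ge0// LipP.
apply/eqP; rewrite eq_le scale_le/=.
have [->|a0] := eqVneq a 0; first by rewrite normR0 mul0r Lip_ge0.
have {1}-> : f = a^-1 *: (a *: f) by rewrite scalerA mulVf// scale1r.
rewrite (le_trans (ler_wpM2l (normR_ge0 _) (scale_le _ _)))// mulrA -normRM.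
by rewrite mulfV// -(of_real1 k) normR_of_real// mul1r.
Qed.

Fact Lip_eq0 (f : Lip0) : of_real (Lip f) = 0 :> K -> f = 0.
Proof.
rewrite -(of_real0 k) => /(can_inj (@of_realK R k)) f0.
apply/val_inj/funext => x /=; apply: normR_eq0; apply/eqP.
rewrite eq_le normR_ge0 andbT; have := LipP f x x0.
by rewrite Lip0_base subr0 f0 mul0r.
Qed.

HB.instance Definition _ := @Lmodule_isNormed.Build K Lip0
  (fun f => of_real (Lip f)) LipD LipZ Lip_eq0.

Lemma normR_Lip0 (f : Lip0) : normR f = Lip f.
Proof. exact: of_realK. Qed.

End lipschitz_space.

Section algebraic_dual.
Context {K : fieldType}.
Variable V : lmodType K.

Definition algdual_pred : {pred V -> K^o} := mem [set f : V -> K^o | linear f].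

Lemma algdual_submod_closed : submod_closed algdual_pred.
Proof.
split; first by apply/mem_set => a u v; rewrite /= scaler0 addr0.
move=> a f g /set_mem lf /set_mem lg; apply/mem_set => b u v.
rewrite !fctE lf lg !scalerDr !scalerA [a * b]mulrC.
by rewrite -!addrA; congr (_ + _); rewrite addrCA.
Qed.

HB.instance Definition _ :=
  GRing.isSubmodClosed.Build _ _ algdual_pred algdual_submod_closed.

Record algdual := AlgDual {
  algdual_fun :> V -> K^o ;
  algdual_funP : algdual_fun \in algdual_pred }.

HB.instance Definition _ := [isSub for algdual_fun].
HB.instance Definition _ := [Choice of algdual by <:].
HB.instance Definition _ := [SubChoice_isSubLmodule of algdual by <:].

Definition linear_span (A : set V) : set V :=
  [set v | exists (n : nat) (a : 'I_n -> K) (w : 'I_n -> V),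
    (forall i, A (w i)) /\ v = \sum_(i < n) a i *: w i].

Lemma linear_span_closed (A : set V) : submod_closed (mem (linear_span A)).
Proof.
split.
  apply/mem_set; exists 0%N, (fun=> 0), (fun=> 0).
  by rewrite big_ord0; split=> // -[].
move=> c u v /set_mem[n [a [w [Aw ->]]]] /set_mem[m [b [z [Az ->]]]].
apply/mem_set; exists (n + m)%N.
exists (fun i => match fintype.split i with inl j => c * a j | inr j => b j end).
exists (fun i => match fintype.split i with inl j => w j | inr j => z j end).
split; first by move=> i; case: (fintype.split i).
rewrite big_split_ord/= scaler_sumr; congr (_ + _); apply: eq_bigr => i _.
  by rewrite (unsplitK (inl i)) scalerA.
by rewrite (unsplitK (inr i)).
Qed.

Lemma linear_span_mem (A : set V) v : A v -> linear_span A v.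
Proof.
move=> Av; exists 1%N, (fun=> 1), (fun=> v); split => //.
by rewrite big_ord1 scale1r.
Qed.

Lemma algdual_linear (f : algdual) : linear f.
Proof. exact: set_mem (algdual_funP f). Qed.

HB.instance Definition _ (f : algdual) :=
  GRing.isLinear.Build K V K^o *:%R f (@algdual_linear f).

End algebraic_dual.

Section lipschitz_tensor_product.
Context {R : realType} {k : scalar_kind}.
Local Notation K := (scalars R k).
Variables (X : metricType R) (x0 : X) (E : normedModType K).

Fact delta_linear (x y : X) (e : E) :
  (fun f : Lip0 x0 (dual E) => (f x - f y) e) \in
    @algdual_pred K (Lip0 x0 (dual E)).
Proof.
apply/mem_set => a f g.
rewrite [X in dual_fun X](_ : _ = a *: (f x - f y) + (g x - g y))//.
by rewrite scalerBr opprD addrACA.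
Qed.

Definition delta (x y : X) (e : E) : algdual (Lip0 x0 (dual E)) :=
  AlgDual (delta_linear x y e).

Definition lip_tensor_pred : {pred algdual (Lip0 x0 (dual E))} :=
  mem (linear_span [set u | exists x y e, u = delta x y e]).

HB.instance Definition _ := GRing.isSubmodClosed.Build _ _ lip_tensor_pred
  (GRing.submod_closed_semi (linear_span_closed _)).

Record lip_tensor := LipTensor {
  lip_tensor_val :> algdual (Lip0 x0 (dual E)) ;
  lip_tensorP : lip_tensor_val \in lip_tensor_pred }.

HB.instance Definition _ := [isSub for lip_tensor_val].
HB.instance Definition _ := [Choice of lip_tensor by <:].
HB.instance Definition _ := [SubChoice_isSubLmodule of lip_tensor by <:].

Fact delta_tensor x y e : delta x y e \in lip_tensor_pred.
Proof. by apply/mem_set/linear_span_mem; exists x, y, e. Qed.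

Definition elem_tensor (x y : X) (e : E) : lip_tensor :=
  LipTensor (delta_tensor x y e).

Definition tensor_of (s : seq (X * X * E)) : lip_tensor :=
  \sum_(p <- s) elem_tensor p.1.1 p.1.2 p.2.

Lemma elem_tensorZ a x y e :
  elem_tensor x y (a *: e) = a *: elem_tensor x y e.
Proof. by do 2 apply: val_inj; apply/funext => f; exact: linearZ. Qed.

Lemma tensor_of_surj (u : lip_tensor) : exists s, u = tensor_of s.
Proof.
have /set_mem[n [a [w [Aw uE]]]] := lip_tensorP u.
have {Aw} /choice[p pP] : forall i, exists p : X * X * E,
    w i = delta p.1.1 p.1.2 p.2.
  by move=> i; have [x [y [e ->]]] := Aw i; exists (x, y, e).
exists [seq ((p i).1, a i *: (p i).2) | i <- enum 'I_n].
apply: val_inj; rewrite [LHS]uE /tensor_of big_map big_enum raddf_sum.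
by apply: eq_bigr => i _; rewrite pP [in RHS]elem_tensorZ.
Qed.

Lemma tensor_ofE s (f : Lip0 x0 (dual E)) :
  tensor_of s f = \sum_(p <- s) (f p.1.1 - f p.1.2) p.2.
Proof.
elim: s => [|p s IHs]; first by rewrite /tensor_of !big_nil.
by rewrite /tensor_of !big_cons -[X in _ = _ + X]IHs.
Qed.

Definition pairing (g : Lip0 x0 K^o) (phi : dual E) (s : seq (X * X * E)) : K :=
  \sum_(p <- s) (g p.1.1 - g p.1.2) * phi p.2.

Definition eps_rep (s : seq (X * X * E)) : R :=
  sup [set r | exists g phi,
    [/\ closed_unit_ball (Lip0 x0 K^o) g, closed_unit_ball (dual E) phi
      & r = normR (pairing g phi s)]].

Lemma eps_rep_has_sup s :
  has_sup [set r | exists g phi,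
    [/\ closed_unit_ball (Lip0 x0 K^o) g, closed_unit_ball (dual E) phi
      & r = normR (pairing g phi s)]].
Proof.
split; first by exists (normR (pairing 0 0 s)), 0, 0; split;
  rewrite // /closed_unit_ball/= normR0.
exists (\sum_(p <- s) mdist p.1.1 p.1.2 * normR p.2) => _ [g [phi [g1 phi1 ->]]].
rewrite /pairing; elim: s => [|p s IHs]; first by rewrite !big_nil normR0.
rewrite !big_cons (le_trans (normRD _ _))// lerD// normRM.
apply: ler_pM; rewrite ?normR_ge0//.
  rewrite (le_trans (LipP g _ _))// -normR_Lip0 -[leRHS]mul1r.
  by rewrite ler_wpM2r// mdist_ge0.
rewrite (le_trans (dual_normP phi _))// -normR_dual -[leRHS]mul1r.
by rewrite ler_wpM2r// normR_ge0.
Qed.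

(* The supremum is taken for a chosen representation of u; epsE below shows
   that every representation gives the same value. *)
Definition eps (u : lip_tensor) : R := eps_rep (sval (cid (tensor_of_surj u))).

Fact rank1 (g : Lip0 x0 K^o) (phi : dual E) :
  (fun x => (g x : K) *: phi) \in @Lip0_pred R k X x0 (dual E).
Proof.
apply/mem_set; split; last by rewrite Lip0_base scale0r.
exists (Lip g * normR phi) => x y; rewrite -scalerBl normRZ mulrAC.
by rewrite ler_wpM2r ?normR_ge0//; exact: LipP.
Qed.

Lemma pairingE g phi s : pairing g phi s = tensor_of s (MkLip0 (rank1 g phi)).
Proof.
rewrite tensor_ofE; apply: eq_bigr => p _.
by rewrite /= -scalerBl.
Qed.

Lemma epsE s : eps (tensor_of s) = eps_rep s.
Proof.
rewrite /eps; case: cid => /= t st.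
suff H : forall g phi, pairing g phi t = pairing g phi s.
  congr sup; apply/seteqP; split=> r [g [phi [g1 phi1 ->]]];
    by exists g, phi; split; rewrite // H.
by move=> g phi; rewrite !pairingE st.
Qed.

(* Norms on the Lipschitz tensor product are functions into R, as the carrier
   is not endowed with a fixed norm. *)
Record is_norm (V : lmodType K) (alpha : V -> R) : Prop := {
  is_norm_ge0 : forall u, 0 <= alpha u ;
  is_norm_eq0 : forall u, alpha u = 0 -> u = 0 ;
  is_normD : forall u v, alpha (u + v) <= alpha u + alpha v ;
  is_normZ : forall (a : K) u, alpha (a *: u) = normR a * alpha u }.

Definition lipschitz_cross_norm (alpha : lip_tensor -> R) : Prop :=
  is_norm alpha /\
  forall x y e, alpha (elem_tensor x y e) = mdist x y * normR e.

Definition dualizable (alpha : lip_tensor -> R) : Prop :=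
  forall g phi s,
    normR (pairing g phi s) <= Lip g * normR phi * alpha (tensor_of s).

End lipschitz_tensor_product.

(* Main.v *)
Require Import Defs.
From HB Require Import structures.
From mathcomp Require Import all_boot all_order all_algebra.
From mathcomp Require Import complex ring.
From mathcomp Require Import all_classical all_reals topology normedtype.
(** Everything but two facts is formal: [eps u] is the supremum of |u (g (.) phi)|
    over the rank-one Lipschitz maps x |-> g x *: phi with g and phi in the unit
    balls, which makes it a seminorm; rescaling g and phi gives dualizability;
    and dualizability of another cross-norm bounds each term of that supremum,
    which gives minimality. The two facts are the value on elementary tensors
    and definiteness.

    Both rest on Hahn-Banach ([norming_functional]): every e in E has a
    functional phi in the unit ball of the dual with |phi e| = ||e||. Together
    with the function z |-> d(z, y) - d(x0, y), which attains d(x, y), this gives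
    eps (delta_(x,y) e) = d(x, y) ||e||.

    For definiteness, let eps u = 0 with u = sum_i delta_(x_i,y_i) e_i. Fixing g
    and letting phi vary, a norming functional shows that
    sum_i (g x_i - g y_i) e_i = 0 in E, for each scalar g. Now u tests vector
    valued maps f only at the finitely many points x_i, y_i, where f is the
    combination sum_q G_q(.) f(q) of Lipschitz bumps G_q with values in the
    scalars ([Lip0_interpolation]); hence u f = 0 ([tensor_of_eq0]).

    Hahn-Banach is proved over both scalar fields at once. Among the functionals
    that are sublinear for real scaling and lie below the norm, Zorn's lemma
    yields a minimal one. Tilting a sublinear functional in a direction v makes it
    additive along v, without increasing it, so a minimal one is already real
    linear. A complex functional is then recovered from its real part. *)

Import Order.TTheory GRing.Theory Num.Theory.
Import numFieldNormedType.Exports.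
Local Open Scope ring_scope.

(** * Sublinear functionals and Hahn-Banach *)

Lemma of_realN (R : realType) (k : scalar_kind) (r : R) :
  of_real (- r) = - of_real r :> scalars R k.
Proof. by case: k => //=; rewrite rmorphN. Qed.

Section sublinear_functionals.
Local Open Scope classical_set_scope.
Local Open Scope ring_scope.
Context {R : realType} {k : scalar_kind}.
Local Notation K := (scalars R k).
Context {V : lmodType K}.
Implicit Types (p q : V -> R) (u v w : V).

(** Homogeneity is required in this weak form because the tilts and infima below
    verify it most directly; equality follows ([sublinearZ]). *)
Record sublinear q : Prop := {
  sublinearD : forall u v, q (u + v) <= q u + q v ;
  sublinear_pZ : forall (r : R) v, 0 < r -> q (of_real r *: v) <= r * q v }.

Lemma sublinear0 q : sublinear q -> q 0 = 0.
Proof.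
move=> sq; apply/eqP; rewrite eq_le; apply/andP; split.
  have : q 0 <= 2^-1 * q 0.
    by rewrite -{1}(scaler0 V (of_real 2^-1 : K)) sublinear_pZ// invr_gt0.
  by rewrite -subr_le0 -{1}[q 0]mul1r -mulrBl pmulr_rle0// subr_gt0 invf_lt1// ltr1n.
by have := sublinearD _ sq 0 0; rewrite addr0 lerDl.
Qed.

Lemma sublinearZ q : sublinear q ->
  forall (r : R) v, 0 <= r -> q (of_real r *: v) = r * q v.
Proof.
move=> sq r v; rewrite le_eqVlt => /predU1P[<-|r0].
  by rewrite of_real0 scale0r mul0r sublinear0.
apply/eqP; rewrite eq_le sublinear_pZ//= mulrC -ler_pdivlMr// mulrC.
rewrite -{1}(scale1r v) -(of_real1 k) -(mulVf (lt0r_neq0 r0)) of_realM -scalerA.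
by rewrite sublinear_pZ// invr_gt0.
Qed.

Lemma sublinearN q v : sublinear q -> - q (- v) <= q v.
Proof.
move=> sq; rewrite lerNl -subr_ge0 opprK -(sublinear0 _ sq) -(addNr v).
exact: sublinearD.
Qed.

Lemma le_inf_add (S T : set R) c : S !=set0 -> T !=set0 ->
  (forall a b, S a -> T b -> c <= a + b) -> c <= inf S + inf T.
Proof.
move=> S0 T0 STc; rewrite -lerBlDr; apply: lb_le_inf => // a Sa.
rewrite lerBlDl -lerBlDr; apply: lb_le_inf => // b Tb.
by rewrite lerBlDl STc.
Qed.

(** The greatest sublinear functional below [q] whose value at [- v] is at most
    [- q v]: moving from w in the direction v is paid for at the rate [q v]. *)
Definition tilt q v w : R :=
  inf [set q (w + of_real t *: v) - t * q v | t in [set t : R | 0 <= t]].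

Lemma tilt_le q v w t : sublinear q -> 0 <= t ->
  tilt q v w <= q (w + of_real t *: v) - t * q v.
Proof.
move=> sq t0; apply: ge_inf; last by exists t.
(* Subadditivity on t v = (w + t v) - w bounds the family below. *)
exists (- q (- w)) => _ [s s0 <-]; rewrite lerBrDr -sublinearZ// addrC lerBlDr.
rewrite -{1}(addrK w (of_real s *: v)) [X in q (X - _)]addrC.
exact: sublinearD.
Qed.

Lemma tilt_le_self q v w : sublinear q -> tilt q v w <= q w.
Proof.
move=> sq; have := tilt_le q v w _ sq (lexx 0).
by rewrite of_real0 scale0r addr0 mul0r subr0.
Qed.

Lemma tilt_opp q v : sublinear q -> tilt q v (- v) <= - q v.
Proof.
move=> sq; have := tilt_le q v (- v) _ sq ler01.
by rewrite of_real1 scale1r addNr sublinear0// mul1r sub0r.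
Qed.

Lemma tilt_nonempty q v w :
  ([set q (w + of_real t *: v) - t * q v | t in [set t : R | 0 <= t]] !=set0).
Proof. by exists (q (w + of_real 0 *: v) - 0 * q v), 0 => //=. Qed.

Lemma tilt_sublinear q v : sublinear q -> sublinear (tilt q v).
Proof.
move=> sq; split.
  move=> w1 w2; apply: le_inf_add; try exact: tilt_nonempty.
  move=> _ _ [t1 t10 <-] [t2 t20 <-]; have t120 : 0 <= t1 + t2 by rewrite addr_ge0.
  apply: (le_trans (tilt_le _ _ _ _ sq t120)).
  rewrite [leRHS]addrACA -opprD -mulrDl lerD2r of_realD scalerDl addrACA.
  exact: sublinearD.
move=> r w r0; rewrite mulrC -ler_pdivrMr//; apply: lb_le_inf.
  exact: tilt_nonempty.
move=> _ [t t0 <-]; have rt0 : 0 <= r * t by rewrite mulr_ge0// ltW.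
rewrite ler_pdivrMr// (le_trans (tilt_le _ _ _ _ sq rt0))//.
rewrite of_realM -scalerA -scalerDr (sublinearZ _ sq _ _ (ltW r0)).
by rewrite [leRHS]mulrC mulrBr mulrA.
Qed.

(** A chain of sublinear functionals below [p] is bounded below pointwise by
    v |-> - p (- v), so its pointwise infimum is again sublinear; subadditivity
    survives because two members of the chain can be replaced by the smaller. *)
Lemma minimal_sublinear p : sublinear p ->
  exists q, [/\ sublinear q, forall v, q v <= p v &
    forall q', sublinear q' -> (forall v, q' v <= q v) -> forall v, q v <= q' v].
Proof.
move=> sp; pose P q := sublinear q /\ forall v, q v <= p v; pose T := {q | P q}.
pose p0 : T := exist P p (conj sp (fun v => lexx (p v))).
pose below (s t : T) := `[< forall v, sval t v <= sval s v >].
have [|s r t /asboolP rs /asboolP st|A Atot|[q [sq qp]] qmin] :=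
    @ZL_preorder T p0 below.
- by move=> t; apply/asboolP.
- by apply/asboolP => v; exact: le_trans (st v) (rs v).
- have [[t0 At0]|A0] := pselect (A !=set0); last first.
    exists p0 => s As.
    by case: A0; exists s.
  pose S v := [set sval t v | t in A].
  have S0 v : (S v !=set0) by exists (sval t0 v), t0.
  have infS v t : A t -> inf (S v) <= sval t v.
    move=> At; apply: ge_inf; last by exists t.
    exists (- p (- v)) => _ [[q [sq qp]] /= _ <-].
    by rewrite (le_trans _ (sublinearN _ _ sq))// lerN2.
  have sinf : sublinear (fun v => inf (S v)).
    split=> [u v|r v r0].
      apply: le_inf_add => // _ _ [t1 At1 <-] [t2 At2 <-].
      have [/asboolP t12|/asboolP t21] := Atot _ _ At1 At2.
        rewrite (le_trans (infS _ _ At2))//.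
        by rewrite (le_trans (sublinearD _ (svalP t2).1 _ _))// lerD2r.
      rewrite (le_trans (infS _ _ At1))//.
      by rewrite (le_trans (sublinearD _ (svalP t1).1 _ _))// lerD2l.
    rewrite mulrC -ler_pdivrMr//; apply: lb_le_inf => // _ [t At <-].
    rewrite ler_pdivrMr// (le_trans (infS _ _ At))// mulrC.
    exact: (sublinear_pZ _ (svalP t).1).
  have infp v : inf (S v) <= p v.
    exact: le_trans (infS _ _ At0) ((svalP t0).2 v).
  exists (exist P _ (conj sinf infp)) => s As.
  by apply/asboolP => v /=; exact: infS.
exists q; split=> // q' sq' q'q.
have q'p v : q' v <= p v by exact: le_trans (q'q v) (qp v).
have /asboolP := qmin (exist P q' (conj sq' q'p)) (asboolT q'q).
exact.
Qed.

(** A minimal functional equals each of its own tilts, hence is odd, hence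
    additive. Starting from the tilt of [p] along [e] instead of [p] forces the
    minimal functional to touch [p] at [e]. *)
Lemma supporting_functional p e : sublinear p ->
  exists F : V -> R,
    [/\ forall u v, F (u + v) = F u + F v,
        forall (r : R) v, F (of_real r *: v) = r * F v,
        forall v, F v <= p v & F e = p e].
Proof.
move=> sp; have sp1 := tilt_sublinear p e sp.
have [F [sF Fp1 Fmin]] := minimal_sublinear _ sp1.
have Fp v : F v <= p v := le_trans (Fp1 v) (tilt_le_self p e v sp).
have FN v : F (- v) = - F v.
  apply/eqP; rewrite eq_le lerNl sublinearN// andbT.
  apply: le_trans (tilt_opp F v sF).
  by apply: Fmin; [exact: tilt_sublinear|move=> w; exact: tilt_le_self].
exists F; split=> //.
- move=> u v; apply/eqP; rewrite eq_le sublinearD//= -lerBrDr -FN.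
  by rewrite -{1}(addrK v u); exact: sublinearD.
- move=> r v; have [r0|r0] := lerP 0 r; first exact: sublinearZ.
  have : F (of_real (- r) *: v) = - r * F v by rewrite sublinearZ// oppr_ge0 ltW.
  by rewrite of_realN scaleNr FN mulNr => /oppr_inj.
- apply/eqP; rewrite eq_le Fp -lerN2 -FN.
  exact: le_trans (Fp1 _) (tilt_opp p e sp).
Qed.

End sublinear_functionals.

Section norming_functional.
Context {R : realType} {k : scalar_kind}.
Local Notation K := (scalars R k).

Lemma real_of_le_normR (z : K) : real_of z <= normR z.
Proof.
rewrite -(ler_of_real k) of_normR.
case: k z => [z|[a b]]; first exact: ler_norm.
apply: le_trans (normc_ge_Re _); rewrite lecR; exact: ler_norm.
Qed.

(** Over the complex scalars phi v = F v - i F (i v). *)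
Lemma real_of_complexification (V : lmodType K) (F : V -> R) :
  (forall u v, F (u + v) = F u + F v) ->
  (forall (r : R) v, F (of_real r *: v) = r * F v) ->
  exists2 phi : V -> K^o, linear phi & forall v, real_of (phi v : K) = F v.
Proof.
case: k V F => V F FD FZ.
  by exists F => // a u v; rewrite FD FZ.
pose i : scalars R ComplexScalars := 'i%C : R[i].
pose G v := F (i *: v).
have cE (c : R[i]) :
    c = real_complex R (complex.Re c) + i * real_complex R (complex.Im c) :> R[i].
  exact: complexE.
have FZc (c : R[i]) w : F ((c : scalars R ComplexScalars) *: w) =
    complex.Re c * F w + complex.Im c * G w.
  by rewrite {1}[c]cE scalerDl FD FZ [i * _]mulrC -scalerA FZ.
have Gi w : G (i *: w) = - F w.
  by rewrite /G scalerA -expr2 sqr_i FZc /= oppr0 mul0r addr0 mulN1r.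
have GZc (c : R[i]) w : G ((c : scalars R ComplexScalars) *: w) =
    complex.Re c * G w - complex.Im c * F w.
  by rewrite /G scalerA mulrC -scalerA FZc Gi mulrN.
exists (fun v => (F v +i* - G v)%C) => // c u v.
rewrite FD FZc /G scalerDr FD -/(G _) -/(G _) GZc.
rewrite /GRing.scale /=; case: c => a b; apply/eqP; rewrite eq_complex /=.
apply/andP; split; apply/eqP; ring.
Qed.

(** Multiplying v by the unimodular c with c (phi v) = |phi v| turns the bound on
    the real part into a bound on the modulus. *)
Lemma linear_normR_le (E : normedModType K) (phi : E -> K^o) :
  linear phi -> (forall v, real_of (phi v : K) <= normR v) ->
  forall v, normR (phi v : K) <= normR v.
Proof.
move=> lphi phi_le v; have [->|z0] := eqVneq (phi v : K) 0.
  by rewrite normR0 normR_ge0.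
pose c : K := `|phi v : K| / phi v.
have phic : phi (c *: v) = `|phi v : K|.
  pose L : {linear E -> K^o} :=
    HB.pack phi (GRing.isLinear.Build K E K^o *:%R phi lphi).
  by rewrite (linearZ_LR L c v : phi (c *: v) = c *: phi v) /GRing.scale /= divfK.
have c1 : normR c = 1.
  by rewrite /normR normrM normfV normr_id divff ?normr_eq0// -(of_real1 k) of_realK.
by rewrite {1}/normR -phic (le_trans (phi_le _))// normRZ c1 mul1r.
Qed.

Lemma norming_functional (E : normedModType K) (e : E) :
  exists2 phi : dual E, normR phi <= 1 & normR (phi e : K) = normR e.
Proof.
have sn : sublinear (normR : E -> R).
  by split=> [u v|r v r0]; [exact: normRD|rewrite normRZ normR_of_real// ltW].
have [F [FD FZ Fle Fe]] := supporting_functional _ e sn.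
have [phi lphi phiF] := real_of_complexification _ _ FD FZ.
have phile : forall v, normR (phi v : K) <= normR v.
  by apply: linear_normR_le => // v; rewrite phiF.
pose L : {linear E -> K^o} :=
    HB.pack phi (GRing.isLinear.Build K E K^o *:%R phi lphi).
have cphi : continuous phi.
  apply/(@linear_bounded_continuous _ _ _ L)/linear_boundedP.
  exists 1; split=> // r r1 v.
  rewrite (@le_trans _ _ `|v|)//.
    by rewrite -!of_normR ler_of_real; exact: phile.
  by rewrite ler_peMl// ltW.
have dphi : phi \in @dual_pred R k E by apply/mem_set.
exists (Dual dphi).
  by rewrite normR_dual; apply: dual_norm_le => v; exact: le_trans (phile v).
by apply/eqP; rewrite eq_le phile/= -Fe -phiF real_of_le_normR.
Qed.

End norming_functional.

(** * Scalar Lipschitz functions *)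

Section lipschitz_functions.
Context {R : realType} {k : scalar_kind} {X : metricType R} (x0 : X).
Local Notation K := (scalars R k).

Lemma normR_of_realB (a b : R) : normR (of_real a - of_real b : K) = `|a - b|.
Proof.
rewrite -of_realN -of_realD; have [r0|r0] := lerP 0 (a - b).
  by rewrite normR_of_real ?ger0_norm.
by rewrite -normRN -of_realN normR_of_real ?ltr0_norm// oppr_ge0 ltW.
Qed.

Lemma real_Lip0 (h : X -> R) (C : R) :
  (forall x y, h x - h y <= C * mdist x y) -> h x0 = 0 ->
  exists2 g : Lip0 x0 K^o, lipschitz_with C g & forall x, g x = of_real (h x).
Proof.
move=> hC h0; have lipg : @lipschitz_with R k X K^o C (fun x => of_real (h x)).
  move=> x y; rewrite [leLHS]normR_of_realB ler_norml hC andbT.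
  by rewrite lerNl opprB metric_sym.
have gP : (fun x => of_real (h x)) \in @Lip0_pred R k X x0 K^o.
  by apply/mem_set; split; [exists C|rewrite h0 of_real0].
by exists (MkLip0 gP).
Qed.

Lemma mdistB_le (x y z : X) : mdist x z - mdist y z <= mdist x y.
Proof. by rewrite lerBlDr metric_triangle. Qed.

Lemma norming_Lip0 (x y : X) :
  exists2 g : Lip0 x0 K^o, Lip g <= 1 & normR (g x - g y : K) = mdist x y.
Proof.
have [u v||g gC gE] := @real_Lip0 (fun z => mdist z y - mdist x0 y) 1.
- by rewrite opprB addrA subrK mul1r mdistB_le.
- by rewrite subrr.
exists g; first exact: Lip_le.
rewrite !gE normR_of_realB opprB addrA subrK mdistxx subr0.
by rewrite ger0_norm// mdist_ge0.
Qed.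

(** Provides the radius of a bump at p that vanishes at all other points of s. *)
Lemma positive_separation (p : X) (s : seq X) :
  exists2 r : R, 0 < r & forall q, q \in s -> q != p -> r <= mdist q p.
Proof.
elim: s => [|a s [r r0 rs]]; first by exists 1.
have [->|ap] := eqVneq a p.
  exists r => // q; rewrite in_cons => /predU1P[->|]; first by rewrite eqxx.
  exact: rs.
exists (Num.min r (mdist a p)); first by rewrite lt_min r0 mdist_gt0.
move=> q; rewrite in_cons => /predU1P[->|qs qp]; first by rewrite ge_min lexx orbT.
by rewrite ge_min rs.
Qed.

Lemma indicator_Lip0 (p : X) (s : seq X) : p != x0 ->
  exists g : Lip0 x0 K^o, forall q, q \in p :: s -> g q = (q == p)%:R.
Proof.
move=> px0; have [r r0 rs] := positive_separation p (x0 :: s).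
(* The bump q |-> max(0, 1 - d(q, p) / r) has slope 1 / r. *)
have hq q : q \in x0 :: s -> q != p -> Num.max 0 (1 - r^-1 * mdist q p) = 0.
  move=> qs qp; apply/max_idPl; rewrite subr_le0 -(mulVf (lt0r_neq0 r0)).
  by rewrite ler_pM2l ?invr_gt0// rs.
have [u v||g gC gE] := @real_Lip0 (fun q => Num.max 0 (1 - r^-1 * mdist q p)) r^-1.
- have ri : 0 <= r^-1 by rewrite invr_ge0 ltW.
  rewrite lerBlDr ge_max; apply/andP; split.
    by rewrite addr_ge0 ?mulr_ge0 ?mdist_ge0// le_max lexx.
  rewrite -lerBlDl le_max; apply/orP; right.
  rewrite -addrA lerD2l -opprD lerN2 -mulrDr ler_wpM2l//.
  by rewrite addrC [mdist u v]metric_sym metric_triangle.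
- by apply: hq; rewrite ?mem_head// eq_sym.
exists g => q; rewrite in_cons gE; have [->|qp /= qs] := eqVneq q p.
  by rewrite mdistxx mulr0 subr0 (max_idPr ler01) of_real1.
by rewrite hq ?of_real0// in_cons qs orbT.
Qed.

(** On finitely many points a Lipschitz map is a combination of its values with
    scalar Lipschitz coefficients. No bump vanishing at the base point can be
    centred there, but f vanishes at that point. *)
Lemma Lip0_interpolation (F : normedModType K) (s : seq X) :
  exists G : X -> Lip0 x0 K^o, forall (f : Lip0 x0 F) x, x \in s ->
    f x = \sum_(q <- undup s) (G q x : K) *: f q.
Proof.
have /choice[G GE] : forall p, exists g : Lip0 x0 K^o,
    p != x0 -> forall q, q \in p :: s -> g q = (q == p)%:R.
  move=> p; have [->|px0] := eqVneq p x0; first by exists 0.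
  by have [g gE] := indicator_Lip0 _ s px0; exists g.
exists G => f x xs; rewrite (bigD1_seq x) ?mem_undup ?undup_uniq//=.
have Gf q : q \in s -> (G q x : K) *: f q = (x == q)%:R *: f q.
  move=> qs; have [->|qx0] := eqVneq q x0; first by rewrite Lip0_base !scaler0.
  by rewrite GE// in_cons xs orbT.
rewrite Gf// eqxx scale1r big1_seq ?addr0// => q /andP[qx].
by rewrite mem_undup => qs; rewrite Gf// eq_sym (negbTE qx) scale0r.
Qed.

End lipschitz_functions.

(** * The injective norm *)

Lemma scaled_from_unit_ball (R : realType) (k : scalar_kind)
    (V : normedModType (scalars R k)) (v : V) :
  exists2 w : V, normR w <= 1 & v = of_real (normR v) *: w.
Proof.
have [v0|v0] := eqVneq (normR v) 0.
  by exists 0; rewrite ?normR0// (normR_eq0 v0) scaler0.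
exists (of_real (normR v)^-1 *: v); last first.
  by rewrite scalerA -of_realM divff// of_real1 scale1r.
by rewrite normRZ normR_of_real ?mulVf// invr_ge0 normR_ge0.
Qed.

Section injective_norm.
Context {R : realType} {k : scalar_kind} {X : metricType R} {x0 : X}.
Local Notation K := (scalars R k).
Context {E : normedModType K}.
Implicit Types (u v : lip_tensor x0 E) (g : Lip0 x0 K^o) (phi : dual E).

(** Unlike [pairing], this depends on the tensor alone and not on a
    representation, and it is linear in u by definition. *)
Definition rank1_eval u g phi : K := u (MkLip0 (rank1 g phi)).

Lemma rank1_eval_tensor_of s g phi :
  rank1_eval (tensor_of x0 s) g phi = pairing g phi s.
Proof. by rewrite pairingE. Qed.

Lemma pairingZ (a b : K) g phi s :
  pairing (a *: g) (b *: phi) s = a * b * pairing g phi s.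
Proof.
rewrite /pairing mulr_sumr; apply: eq_bigr => p _.
have -> : (a *: g) p.1.1 - (a *: g) p.1.2 = a * (g p.1.1 - g p.1.2).
  by rewrite mulrBr.
by rewrite mulrACA.
Qed.

Lemma rank1_eval_le_eps u g phi :
  Lip g <= 1 -> normR phi <= 1 -> normR (rank1_eval u g phi) <= eps u.
Proof.
have [s ->] := tensor_of_surj u; rewrite rank1_eval_tensor_of epsE => g1 phi1.
apply: (sup_upper_bound (eps_rep_has_sup x0 s)); exists g, phi; split=> //.
by rewrite /closed_unit_ball /= normR_Lip0.
Qed.

Lemma eps_le u C :
  (forall g phi, Lip g <= 1 -> normR phi <= 1 ->
     normR (rank1_eval u g phi) <= C) -> eps u <= C.
Proof.
have [s ->] := tensor_of_surj u; rewrite epsE => uC.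
apply: ge_sup; first by case: (eps_rep_has_sup x0 s).
move=> _ [g [phi [g1 phi1 ->]]]; rewrite -rank1_eval_tensor_of uC//.
by rewrite -normR_Lip0.
Qed.

Lemma eps_ge0 u : 0 <= eps u.
Proof.
apply: le_trans (normR_ge0 (rank1_eval u 0 0)) (rank1_eval_le_eps _ _ _ _ _).
  by rewrite -normR_Lip0 normR0 ler01.
by rewrite normR0 ler01.
Qed.

Lemma eps_dualizable : dualizable (@eps R k X x0 E).
Proof.
move=> g phi s; have [g' g'1 gE] := scaled_from_unit_ball _ _ _ g.
have [phi' phi'1 phiE] := scaled_from_unit_ball _ _ _ phi.
rewrite {1}gE {1}phiE pairingZ !normRM !normR_of_real ?normR_ge0//.
rewrite normR_Lip0 ler_wpM2l ?mulr_ge0 ?Lip_ge0 ?normR_ge0//.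
by rewrite -rank1_eval_tensor_of rank1_eval_le_eps// -normR_Lip0.
Qed.

Lemma eps_least (alpha : lip_tensor x0 E -> R) :
  (forall u, 0 <= alpha u) -> dualizable alpha -> forall u, eps u <= alpha u.
Proof.
move=> alpha0 dalpha u; apply: eps_le => g phi g1 phi1.
have [s us] := tensor_of_surj u; rewrite us rank1_eval_tensor_of.
rewrite (le_trans (dalpha g phi s))// ler_piMl//.
by rewrite mulr_ile1 ?Lip_ge0 ?normR_ge0.
Qed.

Lemma epsD u v : eps (u + v) <= eps u + eps v.
Proof.
apply: eps_le => g phi g1 phi1.
rewrite (le_trans (normRD (rank1_eval u g phi) (rank1_eval v g phi)))//.
by rewrite lerD// rank1_eval_le_eps.
Qed.

Lemma epsZ (a : K) u : eps (a *: u) = normR a * eps u.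
Proof.
have scale_le (b : K) v : eps (b *: v) <= normR b * eps v.
  apply: eps_le => g phi g1 phi1.
  rewrite [leLHS](normRM b (rank1_eval v g phi)).
  by rewrite ler_wpM2l ?normR_ge0// rank1_eval_le_eps.
apply/eqP; rewrite eq_le scale_le/=.
have [->|a0] := eqVneq a 0; first by rewrite normR0 mul0r eps_ge0.
have {1}-> : u = a^-1 *: (a *: u) by rewrite scalerA mulVf// scale1r.
rewrite (le_trans (ler_wpM2l (normR_ge0 _) (scale_le _ _)))// mulrA -normRM.
by rewrite mulfV// -(of_real1 k) normR_of_real// mul1r.
Qed.

(** A tensor that vanishes when contracted with every scalar g is zero:
    interpolating f on the points of s expresses its value at f through such
    contractions. *)
Lemma tensor_of_eq0 (s : seq (X * X * E)) :
  (forall g, \sum_(p <- s) (g p.1.1 - g p.1.2 : K) *: p.2 = 0) ->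
  tensor_of x0 s = 0.
Proof.
move=> s0; do 2 apply: val_inj; apply/funext => f /=; rewrite tensor_ofE.
pose pts := [seq p.1.1 | p <- s] ++ [seq p.1.2 | p <- s].
have [G GE] := Lip0_interpolation x0 (dual E) pts.
transitivity (\sum_(q <- undup pts)
    f q (\sum_(p <- s) (G q p.1.1 - G q p.1.2 : K) *: p.2)); last first.
  by rewrite big1 // => q _; rewrite s0 linear0.
under [RHS]eq_bigr do rewrite linear_sum.
rewrite exchange_big; apply: eq_big_seq => p ps.
have p1 : p.1.1 \in pts by rewrite mem_cat; apply/orP; left; apply/mapP; exists p.
have p2 : p.1.2 \in pts by rewrite mem_cat; apply/orP; right; apply/mapP; exists p.
rewrite (GE f _ p1) (GE f _ p2) -sumrB.
transitivity ((\sum_(q <- undup pts) (G q p.1.1 - G q p.1.2 : K) *: f q) p.2).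
  by congr (dual_fun _ _); apply: eq_bigr => q _; rewrite scalerBl.
elim: (undup pts) => [|q l IH]; first by rewrite !big_nil.
by rewrite !big_cons -IH linearZ.
Qed.

(** If all pairings vanish, a norming functional kills each contraction. *)
Lemma eps_eq0 u : eps u = 0 -> u = 0.
Proof.
have [s ->] := tensor_of_surj u => s0; apply: tensor_of_eq0 => g.
set w := \sum_(p <- s) _; apply: normR_eq0.
have [phi phi1 <-] := norming_functional E w.
have -> : (phi w : K) = pairing g phi s.
  by rewrite linear_sum; apply: eq_bigr => p _; rewrite linearZ.
apply/eqP; rewrite eq_le normR_ge0 andbT.
by rewrite (le_trans (eps_dualizable g phi s))// s0 mulr0.
Qed.

Lemma eps_elem_tensor x y e :
  eps (elem_tensor x0 x y e) = mdist x y * normR (e : E).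
Proof.
have evalE g phi : rank1_eval (elem_tensor x0 x y e) g phi = (g x - g y) * phi e.
  have -> : elem_tensor x0 x y e = tensor_of x0 [:: (x, y, e)].
    by rewrite /tensor_of big_seq1.
  by rewrite rank1_eval_tensor_of /pairing big_seq1.
apply/eqP; rewrite eq_le; apply/andP; split.
  apply: eps_le => g phi g1 phi1; rewrite evalE normRM ler_pM ?normR_ge0//.
    by rewrite (le_trans (LipP g x y))// ler_piMl// mdist_ge0.
  by rewrite (le_trans (dual_normP phi e))// ler_piMl ?normR_ge0// -normR_dual.
have [g g1 <-] := @norming_Lip0 R k X x0 x y.
have [phi phi1 <-] := norming_functional E e.
by rewrite -normRM -evalE rank1_eval_le_eps.
Qed.

End injective_norm.

Theorem theorem5p3 (R : realType) (k : scalar_kind) (X : metricType R) (x0 : X)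
    (E : completeNormedModType (scalars R k)) :
  [/\ lipschitz_cross_norm (@eps R k X x0 E),
      dualizable (@eps R k X x0 E)
    & forall alpha : lip_tensor x0 E -> R,
        lipschitz_cross_norm alpha -> dualizable alpha ->
        forall u : lip_tensor x0 E, eps u <= alpha u].
Proof.
split.
- split; last exact: eps_elem_tensor.
  by split; [exact: eps_ge0|exact: eps_eq0|exact: epsD|exact: epsZ].
- exact: eps_dualizable.
- by move=> alpha [[alpha0 _ _ _] _] dalpha u; exact: eps_least.
Qed.
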